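(* Let $M=\mathrm{diag}(2,3)$, $n\in\mathbb{N}$, $n\ge1$, and $\ell\in\{0,\dots,n-1\}$. Suppose the anisotropic symmetric four directional approximating scheme $\mathcal{S}_{B_{n,\ell}}$ of order $(n,\ell)$ with symbol $B_{n,\ell}$ is convergent. Then $\mathcal{S}_{B_{n,\ell}}$ generates polynomials up to degree $2n-1$.
   Context: For $k\ge1$ let $$B_k(z_1,z_2)=6\left(\frac{(1+z_1)^2}{4z_1}\,\frac{(1+z_2+z_2^2)^2}{9z_2^2}\right)^{\lceil k/2\rceil}\left(\frac{(2+z_2+z_1z_2+2z_1z_2^2)(2z_1+z_2+z_1z_2+2z_2^2)}{36z_1z_2^2}\right)^{\lfloor k/2\rfloor},\quad (z_1,z_2)\in(\mathbb{C}\setminus\{0\})^2.$$ For $n\ge1$ and $\ell\in\{0,\dots,n-1\}$ the symbol of the anisotropic symmetric four directional approximating scheme of order $(n,\ell)$ and dilation $M=\mathrm{diag}(2,3)$ is $$B_{n,\ell}(z_1,z_2)=\sum_{i=0}^{\ell}B_{n-i}(z_1,z_2)\sum_{j=0}^{i}\mathrm{c}_n^{(i,j)}\,\delta_1(z_1)^{i-j}\,\delta_2(z_2)^{j},\qquad \delta_1(z_1)=-\frac{(1-z_1^2)^2}{16z_1^2},\quad \delta_2(z_2)=-\frac{(1-z_2^3)^2}{27z_2^3},$$ where the real coefficients $\mathrm{c}_n^{(i,j)}$ are computed recursively (in $i$) as the solution of the system $B_{n,\ell}(1,1)=6$ and $D^{(2(i-j),2j)}B_{n,\ell}(1,1)=0$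 for $j=0,\dots,i$, $i=1,\dots,\ell$. Here $D^{(\mu_1,\mu_2)}=\partial^{\mu_1+\mu_2}/\partial z_1^{\mu_1}\partial z_2^{\mu_2}$. In particular $\mathrm{c}_n^{(0,0)}=1$. The mask $\mathbf{p}$ of a scheme with symbol $p$ is given by the coefficients, $p(\mathbf{z})=\sum_{\boldsymbol{\alpha}\in\mathbb{Z}^2}\mathrm{p}(\boldsymbol{\alpha})z_1^{\alpha_1}z_2^{\alpha_2}$, and the subdivision operator is $(\mathcal{S}_{\mathbf{p}}\mathbf{c})(\boldsymbol{\alpha})=\sum_{\boldsymbol{\beta}\in\mathbb{Z}^2}\mathrm{p}(\boldsymbol{\alpha}-M\boldsymbol{\beta})\mathrm{c}(\boldsymbol{\beta})$. The scheme is convergent if for every $\mathbf{c}\in\ell^\infty(\mathbb{Z}^2)$ there is a uniformly continuous function $F_{\mathbf{c}}:\mathbb{R}^2\to\mathbb{R}$ with $\lim_{k\to\infty}\sup_{\boldsymbol{\alpha}\in\mathbb{Z}^2}|F_{\mathbf{c}}(M^{-k}\boldsymbol{\alpha})-(\mathcal{S}_{\mathbf{p}}^k\mathbf{c})(\boldsymbol{\alpha})|=0$. The basic limit function is $\phi=F_{\boldsymbol{\delta}}$ with $\boldsymbol{\delta}(\boldsymbol{\alpha})=1$ if $\boldsymbol{\alpha}=\mathbf{0}$ and $0$ otherwise; it is compactly supported. Let $\Pi_N$ be the space of bivariate polynomials of total degree at most $N$. A convergent scheme generates polynomials up to degree $N$ if the integer shifts $\phi(\cdot-\boldsymbol{\alpha})$,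 $\boldsymbol{\alpha}\in\mathbb{Z}^2$, span $\Pi_N$, i.e. for every $\pi\in\Pi_N$ there is a sequence $\mathbf{c}:\mathbb{Z}^2\to\mathbb{R}$ with $\sum_{\boldsymbol{\alpha}\in\mathbb{Z}^2}\mathrm{c}(\boldsymbol{\alpha})\phi(\cdot-\boldsymbol{\alpha})=\pi$. *)

(* Defs.v *)
From HB Require Import structures.
From mathcomp Require Import all_boot all_order all_algebra.
From mathcomp Require Import all_classical all_reals all_analysis.
From mathcomp Require Import complex.
Import Order.TTheory GRing.Theory Num.Theory.
Import numFieldNormedType.Exports.
Set Implicit Arguments.
Unset Strict Implicit.
Unset Printing Implicit Defensive.
Local Open Scope classical_set_scope.
Local Open Scope ring_scope.
Local Open Scope complex_scope.

(* The symbols are functions on (C \ {0})^2; the values given by the formulas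
   below at points with a zero coordinate (where x / 0 = 0) are never used. *)

(* ceil(k/2) = uphalf k and floor(k/2) = k./2 *)
Definition symB (R : realType) (k : nat) (z1 z2 : R[i]) : R[i] :=
  6 * ((1 + z1) ^+ 2 / (4 * z1)
       * ((1 + z2 + z2 ^+ 2) ^+ 2 / (9 * z2 ^+ 2))) ^+ uphalf k
    * ((2 + z2 + z1 * z2 + 2 * z1 * z2 ^+ 2)
       * (2 * z1 + z2 + z1 * z2 + 2 * z2 ^+ 2)
       / (36 * z1 * z2 ^+ 2)) ^+ k./2.

Definition delta1 (R : realType) (z1 : R[i]) : R[i] :=
  - ((1 - z1 ^+ 2) ^+ 2 / (16 * z1 ^+ 2)).

Definition delta2 (R : realType) (z2 : R[i]) : R[i] :=
  - ((1 - z2 ^+ 3) ^+ 2 / (27 * z2 ^+ 3)).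

(* B_{n,l} for a given triangular array [c i j], j <= i <= l, of coefficients *)
Definition symBnl (R : realType) (n l : nat) (c : nat -> nat -> R)
    (z1 z2 : R[i]) : R[i] :=
  \sum_(0 <= i < l.+1)
    symB (n - i) z1 z2 *
    \sum_(0 <= j < i.+1) (c i j)%:C * delta1 z1 ^+ (i - j) * delta2 z2 ^+ j.

(* D^(m1,m2) f (z1,z2), with complex partial derivatives *)
Definition mixed_partial (K : numFieldType) (m1 m2 : nat) (f : K -> K -> K)
    (z1 z2 : K) : K :=
  derive1n m1 (fun x : K => derive1n m2 (fun y : K => f x y) z2) z1.

Definition scheme_coefficients (R : realType) (n l : nat)
    (c : nat -> nat -> R) : Prop :=
  symBnl n l c 1 1 = 6 /\
  forall i j : nat, (1 <= i <= l)%N -> (j <= i)%N ->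
    mixed_partial (2 * (i - j)) (2 * j) (symBnl n l c) 1 1 = 0.

(* [p] is the finitely supported sequence of Laurent coefficients of [f] *)
Definition is_mask (R : realType) (p : int * int -> R)
    (f : R[i] -> R[i] -> R[i]) : Prop :=
  finite_set [set a | p a != 0] /\
  forall z1 z2 : R[i], z1 != 0 -> z2 != 0 ->
    f z1 z2 = \sum_(a \in [set: int * int]) (p a)%:C * z1 ^ a.1 * z2 ^ a.2.

(* b |-> M b and a |-> M^(-k) a for M = diag(2,3) *)
Definition dilate (b : int * int) : int * int := (2 * b.1, 3 * b.2).

Definition grid_point (R : realType) (k : nat) (a : int * int) : R * R :=
  (a.1%:~R / 2 ^+ k, a.2%:~R / 3 ^+ k).

Definition subdivision (R : realType) (p : int * int -> R)
    (c : int * int -> R) : int * int -> R :=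
  fun a => \sum_(b \in [set: int * int]) p (a - dilate b) * c b.

Definition is_limit_function (R : realType) (p c : int * int -> R)
    (F : R * R -> R) : Prop :=
  unif_continuous F /\
  (fun k : nat =>
     ereal_sup [set `|F (grid_point R k a) - iter k (subdivision p) c a|%:E
               | a in [set: int * int]]) @ \oo --> 0%E.

Definition convergent (R : realType) (p : int * int -> R) : Prop :=
  forall c : int * int -> R, (exists K : R, forall a, `|c a| <= K) ->
    exists F : R * R -> R, is_limit_function p c F.

Definition delta_seq (R : realType) (a : int * int) : R := (a == 0)%:R.

(* bivariate polynomial functions of total degree at most N *)
Definition Pi (R : realType) (N : nat) : set (R * R -> R) :=
  [set q | exists a : nat -> nat -> R, forall x : R * R,
     q x = \sum_(i < N.+1) \sum_(j < N.+1 | (i + j <= N)%N)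
             a i j * x.1 ^+ i * x.2 ^+ j].

(* [phi] is the basic limit function, which is unique when it exists and
   compactly supported for a finitely supported mask, so that the sum over the
   shifts is pointwise a finite sum. *)
Definition generates_polynomials (R : realType) (p : int * int -> R)
    (N : nat) : Prop :=
  exists phi : R * R -> R, is_limit_function p (@delta_seq R) phi /\
    forall q : R * R -> R, Pi N q ->
      exists c : int * int -> R, forall x : R * R,
        \sum_(a \in [set: int * int]) c a * phi (x - (a.1%:~R, a.2%:~R)) = q x.

(* Main.v *)
Require Import Defs.
From mathcomp Require Import all_boot all_order all_algebra.
From mathcomp Require Import all_classical all_reals all_analysis.
From mathcomp Require Import complex ring lra zify.
Import Order.TTheory GRing.Theory Num.Theory.
Import numFieldNormedType.Exports.
Set Implicit Arguments.
Unset Strict Implicit.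
Unset Printing Implicit Defensive.
Local Open Scope ring_scope.

(** The argument has an algebraic half, about the symbol, and an analytic half,
    about iterating the subdivision operator [S].

    Algebra. Write N = 2n.  At each of the five points (z1, z2) other than
    (1, 1) with z1 ^ 2 = z2 ^ 3 = 1 the symbol vanishes to order N: [B_k]
    vanishes there to order 2k, and each factor [delta1], [delta2] supplies two
    further orders, which makes up for [B_(n-i)] having smaller index
    ([symBnl_vanishes]).  The order of vanishing is tested along the monomial
    curves x |-> (z1 x^u, z2 x) at x = 1, so that only polynomials in one
    variable occur; letting u vary recovers all the mixed moments
    sum_a p(a) z1^a1 z2^a2 a1^i a2^j = 0 for i + j < N ([alias_moments]).
    Fourier inversion on Z/2 x Z/3 then says that the moments of order < N of
    the mask on a coset alpha + M Z^2 do not depend on the coset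
    ([coset_moments]).

    Consequently, on the restriction to Z^2 of a polynomial q of degree < N,
    the operator acts by the single formula
      S q (alpha) = (1/6) sum_e p(e) q(M^-1 (alpha - e)),
    which is triangular in the monomials, with diagonal entries 2^-a 3^-b.
    So for a + b < N there is an eigenpolynomial q_ab with eigenvalue 2^-a 3^-b
    and leading monomial x^a y^b ([eigensequences]); the q_ab are even found in
    the form of an Appell family built from one array of numbers h
    ([appell_fixpoint]).

    Analysis. For any sequence q and any x, S^k q at the lattice point
    alpha_k = floor(M^k x) equals a sum, over a box that does not depend on k,
    of q(b) (S^k delta)(alpha_k - M^k b), and each of these terms tends to
    q(b) phi(x - b) by convergence of the scheme ([iter_subdivision_cvg]).  For
    q = q_ab the left-hand side is 2^-ka 3^-kb q_ab(alpha_k), which tends to the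
    leading monomial x1^a x2^b.  Hence sum_b q_ab(b) phi(x - b) = x1^a x2^b
    exactly ([appell_reproduction]), and linearity gives every polynomial of
    degree at most 2n - 1. *)

(** * Order of vanishing at 1 of Laurent polynomials in one variable *)

Section Vanishing.
Variable F : numFieldType.
Implicit Types (P Q : {poly F}) (g h : F -> F).

Lemma poly_eq_nat P Q : (forall n, P.[n.+1%:R] = Q.[n.+1%:R]) -> P = Q.
Proof.
move=> PQ; apply/eqP; rewrite -subr_eq0; apply/eqP.
apply: (@roots_geq_poly_eq0 _ _ [seq i.+1%:R | i <- iota 0 (size (P - Q))]).
- apply/allP => _ /mapP[i _ ->].
  by rewrite rootE !hornerE PQ subrr.
- by rewrite map_inj_uniq ?iota_uniq// => i j /eqP; rewrite eqr_nat => /eqP[].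
- by rewrite size_map size_iota.
Qed.

Lemma poly_eq_off0 P Q : (forall x, x != 0 -> P.[x] = Q.[x]) -> P = Q.
Proof. by move=> PQ; apply: poly_eq_nat => n; rewrite PQ// pnatr_eq0. Qed.

(** Order of vanishing at 1 of a function that is a Laurent polynomial off 0.
    Clearing denominators by [x ^+ K] keeps the notion inside {poly F}; it is
    about functions because the symbol is given by formulas with quotients. *)
Definition vanishes k g := exists K P,
  forall x, x != 0 -> g x * x ^+ K = (('X - 1) ^+ k * P).[x].

Lemma eq_vanishes k g h :
  (forall x, x != 0 -> g x = h x) -> vanishes k g -> vanishes k h.
Proof. by move=> gh [K [P H]]; exists K, P => x x0; rewrite -gh// H. Qed.

Lemma vanishes_le j k g : (j <= k)%N -> vanishes k g -> vanishes j g.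
Proof.
move=> jk [K [P H]]; exists K, (('X - 1) ^+ (k - j) * P) => x x0.
by rewrite H// mulrA -exprD subnKC.
Qed.

Lemma vanishesD k g h :
  vanishes k g -> vanishes k h -> vanishes k (fun x => g x + h x).
Proof.
move=> [K [P HP]] [L [Q HQ]].
exists (K + L)%N, (P * 'X^L + Q * 'X^K) => x x0.
rewrite mulrDl exprD mulrA HP// [X in _ + h x * X]mulrC mulrA HQ//.
by rewrite !hornerE; ring.
Qed.

Lemma vanishes_sum (I : Type) (r : seq I) k (g : I -> F -> F) :
  (forall i, vanishes k (g i)) -> vanishes k (fun x => \sum_(i <- r) g i x).
Proof.
move=> H; elim: r => [|i r IH].
  by exists 0%N, 0 => x _; rewrite big_nil mul0r mulr0 horner0.
by apply: eq_vanishes (vanishesD (H i) IH) => x _; rewrite big_cons.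
Qed.

Lemma vanishesM j k g h :
  vanishes j g -> vanishes k h -> vanishes (j + k) (fun x => g x * h x).
Proof.
move=> [K [P HP]] [L [Q HQ]].
exists (K + L)%N, (P * Q) => x x0.
have -> : g x * h x * x ^+ (K + L) = (g x * x ^+ K) * (h x * x ^+ L).
  by rewrite exprD; ring.
by rewrite HP// HQ// exprD !hornerM; ring.
Qed.

Lemma vanishesX k g m : vanishes k g -> vanishes (k * m) (fun x => g x ^+ m).
Proof.
move=> H; elim: m => [|m IH].
  by exists 0%N, 1 => x _; rewrite muln0 !hornerE.
by rewrite mulnS; apply: eq_vanishes (vanishesM H IH) => x _; rewrite exprS.
Qed.

Lemma vanishes_poly P : vanishes 0 (horner P).
Proof. by exists 0%N, P => x _; rewrite expr0 mulr1 mul1r. Qed.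

Lemma vanishes_root P : root P 1 -> vanishes 1 (horner P).
Proof.
case/factor_theorem=> Q ->; exists 0%N, Q => x _.
by rewrite expr0 mulr1 expr1 mulrC.
Qed.

Lemma vanishes_cst c : vanishes 0 (fun=> c).
Proof. by apply: eq_vanishes (vanishes_poly c%:P) => x _; rewrite hornerC. Qed.

Lemma vanishes_monomialV c m : vanishes 0 (fun x => (c * x ^+ m)^-1).
Proof.
exists m, (c^-1)%:P => x x0.
by rewrite expr0 mul1r hornerC invfM mulfVK// expf_neq0.
Qed.

(** The Euler operator x d/dx, shifted by c: the monomial x^d is an eigenvector
    with eigenvalue d - c, so that iterating and evaluating at 1 produces power
    moments of the exponents. *)
Definition euler c P := 'X * P^`() - c *: P.

Lemma iter_euler_monomials (I : Type) (s : seq I) (w : I -> F) (d : I -> nat)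
    c m :
  iter m (euler c) (\sum_(i <- s) w i *: 'X^(d i)) =
  \sum_(i <- s) (w i * ((d i)%:R - c) ^+ m) *: 'X^(d i).
Proof.
elim: m => [|m IH]; first by apply: eq_bigr => i _; rewrite expr0 mulr1.
rewrite iterS IH /euler raddf_sum/= mulr_sumr scaler_sumr -sumrB.
apply: eq_bigr => i _.
rewrite derivZ derivXn -scalerAr scalerA mulrnAr -exprS.
have -> : 'X^((d i).-1.+1) *+ d i = ((d i)%:R : F) *: 'X^(d i) :> {poly F}.
  by rewrite scaler_nat; case: (d i).
by rewrite scalerA -scalerBl exprS; congr (_ *: _); ring.
Qed.

(** Each application of [euler c] lowers the order of vanishing at 1 by at most
    one. *)
Lemma euler_vanishes c k P m : (m < k)%N ->
  (iter m (euler c) (('X - 1) ^+ k * P)).[1] = 0.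
Proof.
elim: m k P => [|m IH] k P mk.
  by case: k mk => // k _; rewrite /= exprS !hornerE subrr !mul0r.
case: k mk => // k mk; rewrite iterSr.
suff -> : euler c (('X - 1) ^+ k.+1 * P) =
    ('X - 1) ^+ k * ('X * ('X - 1) * P^`() + k.+1%:R *: ('X * P)
      - c *: (('X - 1) * P)) by exact: IH.
rewrite /euler derivM -[1]/(1%:P) deriv_exp derivXsubC mul1r.
rewrite exprS /= -!mul_polyC polyCMn -mulr_natl -[1%:P *+ _]mulr_natl; ring.
Qed.

(** After multiplication by a power of x the exponents become natural numbers
    d i = e i + const; iterating the Euler operator shifted by that constant
    turns vanishing at 1 directly into moments of the e i themselves. *)
Lemma vanishes_moments (I : eqType) (s : seq I) (w : I -> F) (e : I -> int)
    k m :
  vanishes k (fun x => \sum_(i <- s) w i * x ^ e i) -> (m < k)%N ->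
  \sum_(i <- s) w i * (e i)%:~R ^+ m = 0.
Proof.
move=> [K [P HP]] mk.
pose N := (\sum_(i <- s) `|e i|)%N.
have eN i : i \in s -> 0 <= e i + N%:Z.
  move=> si; have : (`|e i| <= N)%N by rewrite /N (big_rem i)//= leq_addr.
  lia.
pose d i := (`|(e i + N%:Z)%R| + K)%N.
have dE i : i \in s -> (d i)%:Z = e i + N%:Z + K%:Z.
  by move=> /eN ei; rewrite /d PoszD gez0_abs.
have QE : \sum_(i <- s) w i *: 'X^(d i) = ('X - 1) ^+ k * (P * 'X^N).
  apply: poly_eq_off0 => x x0; rewrite mulrA hornerM -HP// hornerXn.
  rewrite -mulrA -exprD addnC mulr_suml horner_sum; apply: eq_big_seq => i si.
  rewrite hornerZ hornerXn -mulrA; congr (_ * _).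
  by rewrite !exprnP dE// PoszD -expfzDr// addrA.
have := euler_vanishes (N%:R + K%:R) (P * 'X^N) mk.
rewrite -QE iter_euler_monomials horner_sum => {2}<-.
apply: eq_big_seq => i si; rewrite hornerZ hornerXn expr1n mulr1.
by rewrite -[(d i)%:R]/((d i)%:Z%:~R) dE// !intrD; congr (_ * _ ^+ _); ring.
Qed.

End Vanishing.

(** * Zeros of the symbol *)

Section Zeros.
Variable R : realType.
Local Notation C := R[i].
Local Open Scope complex_scope.

(* Powers come before products, because 'X^2 also unifies with a product. *)
Let evalE := (hornerXn, hornerX, hornerC, hornerD, hornerN, hornerM).

(** The points other than (1, 1) whose coordinates are a square and a cube root
    of unity, that is, the other points of the dual group of Z^2 / M Z^2. *)
Definition alias (z1 z2 : C) :=
  [\/ z1 = -1 /\ z2 = 1, z1 = 1 /\ 1 + z2 + z2 ^+ 2 = 0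
    | z1 = -1 /\ 1 + z2 + z2 ^+ 2 = 0].

(** The three kinds of points use different factors.  At (-1, 1) and (1, w) one
    of the two squared factors gives order 2 and the two remaining factors of
    [symB] give order 1 each, for a total of 2 ceil(k/2) + 2 floor(k/2) = 2k;
    at (-1, w) only the squared factors vanish, to order
    4 ceil(k/2) >= 2k. *)
Lemma symB_vanishes z1 z2 u k : alias z1 z2 ->
  vanishes (2 * k) (fun x : C => symB k (z1 * x ^+ u) (z2 * x)).
Proof.
move=> z12.
pose P1 : {poly C} := 1%:P + z1%:P * 'X^u.
pose P2 : {poly C} := 1%:P + z2%:P * 'X + (z2 ^+ 2)%:P * 'X^2.
pose Q1 : {poly C} := 2%:P + z2%:P * 'X + (z1 * z2)%:P * 'X^u * 'X
  + (2 * z1 * z2 ^+ 2)%:P * 'X^u * 'X^2.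
pose Q2 : {poly C} := (2 * z1)%:P * 'X^u + z2%:P * 'X
  + (z1 * z2)%:P * 'X^u * 'X + (2 * z2 ^+ 2)%:P * 'X^2.
have vD1 : vanishes 0 (fun x : C => (4 * z1 * x ^+ u)^-1).
  exact: vanishes_monomialV.
have vD2 : vanishes 0 (fun x : C => (9 * z2 ^+ 2 * x ^+ 2)^-1).
  exact: vanishes_monomialV.
have vD3 : vanishes 0 (fun x : C => (36 * z1 * z2 ^+ 2 * x ^+ (u + 2))^-1).
  exact: vanishes_monomialV.
have combine o1 o2 o3 o4 :
    vanishes o1 (horner P1) -> vanishes o2 (horner P2) ->
    vanishes o3 (horner Q1) -> vanishes o4 (horner Q2) ->
    (2 * k <= (o1 * 2 + o2 * 2) * uphalf k + (o3 + o4) * k./2)%N ->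
    vanishes (2 * k) (fun x : C => symB k (z1 * x ^+ u) (z2 * x)).
  move=> v1 v2 v3 v4 le_k; apply: vanishes_le le_k _.
  have w1 := vanishesM (vanishesX 2 v1) vD1.
  have w2 := vanishesM (vanishesX 2 v2) vD2.
  have w3 := vanishesM (vanishesM v3 v4) vD3.
  have := vanishesM (vanishesM (vanishes_cst 6)
    (vanishesX (uphalf k) (vanishesM w1 w2))) (vanishesX k./2 w3).
  rewrite add0n !addn0; apply: eq_vanishes => x _.
  rewrite /symB /P1 /P2 /Q1 /Q2 !evalE.
  by congr (6 * (_ / _ * (_ / _)) ^+ _ * (_ * _ / _) ^+ _);
    rewrite ?exprD; ring.
have k2 : (uphalf k + k./2 = k)%N by lia.
have v0 := vanishes_poly; have v1 P : P.[1] = 0 -> vanishes 1 (horner P).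
  by move=> /eqP; exact: vanishes_root.
case: z12 => [[-> ->]|[-> z2E]|[-> z2E]] in P1 P2 Q1 Q2 vD1 vD2 vD3 combine *.
- apply: (combine 1 0 1 1)%N; [apply: v1|exact: v0|apply: v1|apply: v1|lia];
    rewrite /P1 /Q1 /Q2 !evalE ?expr1n; ring.
- apply: (combine 0 1 1 1)%N; [exact: v0|apply: v1|apply: v1|apply: v1|lia];
    rewrite /P2 /Q1 /Q2 !evalE ?expr1n.
  + by rewrite -[RHS]z2E; ring.
  + by rewrite -[RHS](mulr0 2) -z2E; ring.
  + by rewrite -[RHS](mulr0 2) -z2E; ring.
- apply: (combine 1 1 0 0)%N; [apply: v1|apply: v1|exact: v0|exact: v0|lia];
    rewrite /P1 /P2 !evalE ?expr1n.
  + by ring.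
  + by rewrite -[RHS]z2E; ring.
Qed.

Lemma delta1_vanishes z1 u : z1 ^+ 2 = 1 ->
  vanishes 2 (fun x : C => delta1 (z1 * x ^+ u)).
Proof.
move=> z1E; pose P : {poly C} := 1%:P - 'X^(u * 2).
have vP : vanishes 1 (horner P).
  by apply: vanishes_root; rewrite rootE !evalE expr1n subrr.
have := vanishesM (vanishes_cst (-1))
  (vanishesM (vanishesX 2 vP) (vanishes_monomialV 16 (u * 2))).
apply: eq_vanishes => x _.
by rewrite /delta1 /P !evalE exprMn z1E !mul1r mulN1r exprM.
Qed.

Lemma delta2_vanishes z2 : z2 ^+ 3 = 1 ->
  vanishes 2 (fun x : C => delta2 (z2 * x)).
Proof.
move=> z2E; pose P : {poly C} := 1%:P - 'X^3.
have vP : vanishes 1 (horner P).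
  by apply: vanishes_root; rewrite rootE !evalE expr1n subrr.
have := vanishesM (vanishes_cst (-1))
  (vanishesM (vanishesX 2 vP) (vanishes_monomialV 27 3)).
apply: eq_vanishes => x _.
by rewrite /delta2 /P !evalE exprMn z2E !mul1r mulN1r.
Qed.

Lemma alias_roots z1 z2 : alias z1 z2 -> z1 ^+ 2 = 1 /\ z2 ^+ 3 = 1.
Proof.
have cube : 1 + z2 + z2 ^+ 2 = 0 -> z2 ^+ 3 = 1.
  move=> z2E; apply/eqP; rewrite -subr_eq0; apply/eqP.
  by rewrite -[RHS](mulr0 (z2 - 1)) -z2E; ring.
by case=> -[-> z2E]; rewrite ?sqrrN expr1n; split=> //;
  [rewrite z2E expr1n | exact: cube | exact: cube].
Qed.

(** The i-th summand has order 2(n - i) from [symB (n - i)] and 2i from the i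
    factors [delta1], [delta2]. *)
Lemma symBnl_vanishes n l c z1 z2 u : (l < n)%N -> alias z1 z2 ->
  vanishes (2 * n) (fun x : C => symBnl n l c (z1 * x ^+ u) (z2 * x)).
Proof.
move=> ln z12; have [z1E z2E] := alias_roots z12.
have d1 := delta1_vanishes u z1E; have d2 := delta2_vanishes z2E.
have summand (i : 'I_l.+1) : vanishes (2 * n) (fun x : C =>
    symB (n - i) (z1 * x ^+ u) (z2 * x) *
    \sum_(j < i.+1) (c i j)%:C * delta1 (z1 * x ^+ u) ^+ (i - j)
      * delta2 (z2 * x) ^+ j).
  have -> : (2 * n = 2 * (n - i) + 2 * i)%N.
    by rewrite -mulnDr subnK// ltnW// (leq_trans (ltn_ord i)).
  apply: vanishesM; first exact: symB_vanishes.
  apply: vanishes_sum => j.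
  have -> : (2 * i = 0 + 2 * (i - j) + 2 * j)%N.
    by rewrite add0n -mulnDr subnK// -ltnS.
  exact: vanishesM (vanishesM (vanishes_cst _) (vanishesX _ d1))
    (vanishesX _ d2).
apply: eq_vanishes (vanishes_sum (index_enum 'I_l.+1) summand) => x _.
rewrite /symBnl big_mkord; apply: eq_bigr => i _; congr (_ * _).
by rewrite big_mkord.
Qed.

End Zeros.

(** * Finitely supported sums and indicators of residue classes *)

Lemma fsum_seq (V : nmodType) (I : choiceType) (s : seq I) (f : I -> V) :
  uniq s -> (forall a, a \notin s -> f a = 0) ->
  \sum_(a \in [set: I]) f a = \sum_(a <- s) f a.
Proof.
move=> us f0; rewrite (fsbigE s)//; last by move=> a _ /f0.
by apply: eq_bigl => a; rewrite in_setT.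
Qed.

Section Characters.
Variable R : realType.
Local Notation C := R[i].
Local Open Scope complex_scope.

Lemma cube_root_exists : exists w : C, 1 + w + w ^+ 2 = 0.
Proof.
pose t : C := (Num.sqrt 3)%:C.
have tE : t ^+ 2 = 3 by rewrite -rmorphXn/= sqr_sqrtr// rmorph_nat.
exists ((- 1 + 'i * t) / 2).
have -> : 1 + (- 1 + 'i * t) / 2 + ((- 1 + 'i * t) / 2) ^+ 2
   = (3 + 'i ^+ 2 * t ^+ 2) / 4 :> C by field.
by rewrite tE sqr_i mulN1r subrr mul0r.
Qed.

Lemma dvd2_indicator (d : int) : ((2 %| d)%Z)%:R = (1 + (-1) ^ d) / 2 :> C.
Proof.
have m1 : (-1) ^ (2 : int) = 1 :> C by rewrite -exprnP sqrrN expr1n.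
have [q [dE|dE]] : exists q : int, d = 2 * q \/ d = 2 * q + 1.
  exists (d %/ 2)%Z; have := divz_eq d 2.
  have := modz_ge0 d (_ : 2 != 0 :> int).
  have := ltz_pmod d (_ : 0 < 2 :> int); lia.
- have -> : (2 %| d)%Z by rewrite dE dvdz_mulr.
  by rewrite dE -exprz_exp m1 exp1rz divff ?pnatr_eq0.
- have -> : (2 %| d)%Z = false by lia.
  by rewrite dE expfzDr ?oppr_eq0 ?oner_eq0// -exprz_exp m1 exp1rz
    expr1z mul1r subrr mul0r.
Qed.

Lemma dvd3_indicator (w : C) (d : int) : 1 + w + w ^+ 2 = 0 ->
  ((3 %| d)%Z)%:R = (1 + w ^ d + (w ^+ 2) ^ d) / 3.
Proof.
move=> wE.
have w3 : w ^+ 3 = 1.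
  apply/eqP; rewrite -subr_eq0; apply/eqP.
  by rewrite -[RHS](mulr0 (w - 1)) -wE; ring.
have w0 : w != 0.
  by apply: contra_eq_neq w3 => ->; rewrite expr0n eq_sym oner_eq0.
have red q r : w ^ (3 * q + r) = w ^ r.
  by rewrite expfzDr// -exprz_exp -exprnP w3 exp1rz mul1r.
have -> : (w ^+ 2) ^ d = w ^ (2 * d) by rewrite exprnP exprz_exp.
have [q [dE|dE|dE]] : exists q : int, [\/ d = 3 * q, d = 3 * q + 1
    | d = 3 * q + 2].
  exists (d %/ 3)%Z; have := divz_eq d 3.
  have := modz_ge0 d (_ : 3 != 0 :> int).
  have := ltz_pmod d (_ : 0 < 3 :> int) => /(_ isT) lt3 /(_ isT) ge0 eq3.
  have : (d %% 3)%Z = 0 \/ (d %% 3)%Z = 1 \/ (d %% 3)%Z = 2 by lia.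
  by case=> [|[]] E; [constructor 1|constructor 2|constructor 3]; lia.
- have -> : (3 %| d)%Z by lia.
  have -> : 2 * d = 3 * (2 * q) + 0 by lia.
  by rewrite dE -[3 * q]addr0 !red expr0z -(natrD _ 2 1) divff ?pnatr_eq0.
- have -> : (3 %| d)%Z = false by lia.
  have -> : 2 * d = 3 * (2 * q) + 2 by lia.
  by rewrite dE !red expr1z -exprnP wE mul0r.
- have -> : (3 %| d)%Z = false by lia.
  have -> : 2 * d = 3 * (2 * q + 1) + 1 by lia.
  by rewrite dE !red expr1z -exprnP addrAC wE mul0r.
Qed.

End Characters.

(** * Sum rules for the mask *)

Section Cosets.
Variables (R : realType) (n l : nat) (c : nat -> nat -> R) (p : int * int -> R).
Variable s : seq (int * int).
Hypotheses (l_lt_n : (l < n)%N) (mask_p : is_mask p (symBnl n l c)).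
Hypotheses (s_uniq : uniq s) (p_supp : forall a, a \notin s -> p a = 0).
Local Notation C := R[i].
Local Open Scope complex_scope.

Lemma symbol_sum (z1 z2 : C) : z1 != 0 -> z2 != 0 ->
  symBnl n l c z1 z2 = \sum_(a <- s) (p a)%:C * z1 ^ a.1 * z2 ^ a.2.
Proof.
move=> z10 z20; rewrite mask_p.2//; apply: fsum_seq => // a /p_supp ->.
by rewrite !mul0r.
Qed.

(** Along (z1 x^u, z2 x) the vanishing of the symbol reads
    sum_a w_a (u a1 + a2)^m = 0 for m < 2n.  For m = i + j the left-hand side is
    a polynomial in u with infinitely many zeros, whose coefficient of u^i is a
    nonzero multiple of the moment in question. *)
Lemma alias_moments (z1 z2 : C) i j : alias z1 z2 -> (i + j < 2 * n)%N ->
  \sum_(a <- s) (p a)%:C * z1 ^ a.1 * z2 ^ a.2 *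
    (a.1%:~R ^+ i * a.2%:~R ^+ j) = 0.
Proof.
move=> z12 ij.
have [z1E z2E] := alias_roots z12.
have z10 : z1 != 0
  by apply: contra_eq_neq z1E => ->; rewrite expr0n eq_sym oner_eq0.
have z20 : z2 != 0
  by apply: contra_eq_neq z2E => ->; rewrite expr0n eq_sym oner_eq0.
pose w (a : int * int) := (p a)%:C * z1 ^ a.1 * z2 ^ a.2.
pose E k : C := \sum_(a <- s) w a * (a.1%:~R ^+ k * a.2%:~R ^+ (i + j - k)).
have curve u : \sum_(a <- s) w a * (u%:Z * a.1 + a.2)%:~R ^+ (i + j) = 0.
  apply: (vanishes_moments (k := 2 * n)) => //.
  apply: eq_vanishes (symBnl_vanishes c u l_lt_n z12) => x x0.
  rewrite symbol_sum ?mulf_neq0 ?expf_neq0//; apply: eq_bigr => a _.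
  rewrite !expfzMl expfzDr// exprnP exprz_exp /w !mulrA; congr (_ * _).
  by rewrite -!mulrA; congr (_ * (_ * _)); rewrite mulrC.
have polyE : \poly_(k < (i + j).+1) (E k *+ 'C(i + j, k)) = 0.
  apply: poly_eq_nat => u; rewrite horner0 -[RHS](curve u.+1) horner_poly.
  under eq_bigr do rewrite /E -sumrMnl mulr_suml.
  rewrite exchange_big/=; apply: eq_bigr => a _.
  rewrite intrD intrM addrC exprDn mulr_sumr; apply: eq_bigr => k _.
  rewrite exprMn mulrnAl mulrnAr; congr (_ *+ _).
  rewrite -[LHS]mulrA; congr (_ * _).
  by rewrite -[LHS]mulrA [LHS]mulrC -[LHS]mulrA.
have /eqP := congr1 (fun q : {poly C} => q`_i) polyE.
rewrite coef_poly coef0 ltnS leq_addr mulrn_eq0 eqn0Ngt bin_gt0 leq_addr/=.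
by rewrite /E addKn => /eqP.
Qed.

Definition coset_member (alpha a : int * int) :=
  (2 %| alpha.1 - a.1)%Z && (3 %| alpha.2 - a.2)%Z.

(** The indicator of the coset of alpha is the mean of the six characters
    a |-> z1^(a1 - alpha1) z2^(a2 - alpha2); all but the trivial one contribute
    a vanishing moment. *)
Lemma coset_moments alpha i j : (i + j < 2 * n)%N ->
  \sum_(a <- s | coset_member alpha a)
    p a * (a.1%:~R ^+ i * a.2%:~R ^+ j) =
  6^-1 * \sum_(a <- s) p a * (a.1%:~R ^+ i * a.2%:~R ^+ j).
Proof.
move=> ij; apply: (fmorph_inj (real_complex R)).
have [w wE] := cube_root_exists R.
have w2E : 1 + w ^+ 2 + (w ^+ 2) ^+ 2 = 0.
  by rewrite -[RHS](mulr0 (1 - w + w ^+ 2)) -wE; ring.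
have w0 : w != 0.
  by apply: contra_eq_neq wE => ->; rewrite expr0n !addr0 oner_eq0.
have m0 : -1 != 0 :> C by rewrite oppr_eq0 oner_eq0.
pose q (a : int * int) : C := (p a)%:C * (a.1%:~R ^+ i * a.2%:~R ^+ j).
have mom z1 z2 : alias z1 z2 -> \sum_(a <- s) q a * (z1 ^ a.1 * z2 ^ a.2) = 0.
  move=> z12; rewrite -[RHS](alias_moments z12 ij).
  by apply: eq_bigr => a _; rewrite /q; ring.
have sgn : \sum_(a <- s) q a * ((- 1) ^ a.1 * 1 ^ a.2) = 0.
  by apply: mom; constructor 1.
have om1 : \sum_(a <- s) q a * (1 ^ a.1 * w ^ a.2) = 0.
  by apply: mom; constructor 2.
have om2 : \sum_(a <- s) q a * (1 ^ a.1 * (w ^+ 2) ^ a.2) = 0.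
  by apply: mom; constructor 2.
have som1 : \sum_(a <- s) q a * ((-1) ^ a.1 * w ^ a.2) = 0.
  by apply: mom; constructor 3.
have som2 : \sum_(a <- s) q a * ((-1) ^ a.1 * (w ^+ 2) ^ a.2) = 0.
  by apply: mom; constructor 3.
have drop_zero_moments (S S1 S2 S3 S4 S5 x1 x2 x3 x4 x5 : C) :
    S1 = 0 -> S2 = 0 -> S3 = 0 -> S4 = 0 -> S5 = 0 ->
    6^-1 * (S + x1 * S1 + x2 * S2 + x3 * S3 + x4 * S4 + x5 * S5) = 6^-1 * S.
  by do 5 move=> ->; rewrite !mulr0 !addr0.
pose A : C := (-1) ^ (- alpha.1); pose B1 := w ^ (- alpha.2).
pose B2 := (w ^+ 2) ^ (- alpha.2).
transitivity (
  6^-1 * (\sum_(a <- s) q a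
    + A * (\sum_(a <- s) q a * ((- 1) ^ a.1 * 1 ^ a.2))
    + B1 * (\sum_(a <- s) q a * (1 ^ a.1 * w ^ a.2))
    + B2 * (\sum_(a <- s) q a * (1 ^ a.1 * (w ^+ 2) ^ a.2))
    + A * B1 * (\sum_(a <- s) q a * ((-1) ^ a.1 * w ^ a.2))
    + A * B2 * (\sum_(a <- s) q a * ((-1) ^ a.1 * (w ^+ 2) ^ a.2)))).
  rewrite !mulr_sumr -!big_split mulr_sumr rmorph_sum big_mkcond/=.
  apply: eq_bigr => a _.
  rewrite !exp1rz !mulr1 !mul1r.
  transitivity (q a *
      (((2 %| a.1 - alpha.1)%Z)%:R * ((3 %| a.2 - alpha.2)%Z)%:R)).
    have -> : (2 %| a.1 - alpha.1)%Z = (2 %| alpha.1 - a.1)%Z by lia.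
    have -> : (3 %| a.2 - alpha.2)%Z = (3 %| alpha.2 - a.2)%Z by lia.
    rewrite -natrM mulnb /coset_member.
    case: ifP => _; last by rewrite mulr0.
    by rewrite mulr1 /q !rmorphM !rmorphXn/= !rmorph_int.
  rewrite dvd2_indicator (dvd3_indicator _ wE) !expfzDr ?expf_neq0//.
  by rewrite -/A -/B1 -/B2; field.
rewrite (drop_zero_moments _ _ _ _ _ _ _ _ _ _ _ sgn om1 om2 som1 som2).
rewrite [RHS]rmorphM [X in _ = X * _]fmorphV [X in _ = X^-1 * _]rmorph_nat.
congr (_ * _).
rewrite [RHS]rmorph_sum; apply: eq_bigr => a _.
by rewrite /q !rmorphM !rmorphXn/= !rmorph_int.
Qed.

Lemma mask_sum : symBnl n l c 1 1 = 6 -> \sum_(a <- s) p a = 6.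
Proof.
rewrite symbol_sum ?oner_eq0// => H; apply: (fmorph_inj (real_complex R)).
rewrite rmorph_nat rmorph_sum -H; apply: eq_bigr => a _.
by rewrite !exp1rz !mulr1.
Qed.

End Cosets.

(** * Appell polynomials in two variables *)

Section Appell.
Variable F : numFieldType.
Implicit Types (u v : nat -> F) (h : nat -> nat -> F).

(** In umbral notation this is (u + x)^a with u^i replaced by [u i]. *)
Definition appell1 a u x := \sum_(i < a.+1) (u i * x ^+ (a - i)) *+ 'C(a, i).

Lemma eq_appell1 a u v x : (forall i, (i <= a)%N -> u i = v i) ->
  appell1 a u x = appell1 a v x.
Proof. by move=> uv; apply: eq_bigr => i _; rewrite uv// -ltnS. Qed.

Lemma bin_trinomial a s i : (i <= s <= a)%N ->
  ('C(a, i) * 'C(a - i, s - i) = 'C(a, s) * 'C(s, i))%N.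
Proof.
move=> /andP[le_is le_sa]; have le_ia := leq_trans le_is le_sa.
have fp k : (0 < k`!)%N := fact_gt0 k.
apply/eqP; rewrite -(eqn_pmul2r (fp i)) -(eqn_pmul2r (fp (s - i)%N)).
rewrite -(eqn_pmul2r (fp (a - s)%N)); apply/eqP.
have le2 : (s - i <= a - i)%N by rewrite leq_sub2r.
have := bin_fact le_ia; have := bin_fact le2.
have := bin_fact le_sa; have := bin_fact le_is.
have -> : (a - i - (s - i) = a - s)%N by lia.
move=> <- <- E1 E2; transitivity ('C(a, i) * i`! * (a - i)`!)%N.
  by rewrite -E1; ring.
by rewrite -mulnA E2; ring.
Qed.

(** Umbrally, (u + (x + g))^a = ((u + g) + x)^a. *)
Lemma appell1_shift a u x g :
  appell1 a u (x + g) = appell1 a (fun s => appell1 s u g) x.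
Proof.
pose G i s := (u i * g ^+ (s - i) * x ^+ (a - s)) *+ ('C(a, s) * 'C(s, i)).
transitivity (\sum_(i < a.+1) \sum_(s < a.+1 | (i <= s)%N) G i s).
  apply: eq_bigr => i _; have le_ia : (i <= a)%N by rewrite -ltnS.
  rewrite -(big_geq_mkord i a.+1 predT) -[X in index_iota X]add0n big_addn.
  rewrite subSn// big_mkord exprDn mulr_sumr -sumrMnl; apply: eq_bigr => k _.
  have le_k : (k <= a - i)%N by rewrite -ltnS.
  rewrite /G -bin_trinomial; last by lia.
  rewrite addnK mulrnAr -mulrnA [in RHS]mulnC.
  have -> : (a - (k + i) = a - i - k)%N by lia.
  by congr (_ *+ _); rewrite -mulrA; congr (_ * _); rewrite mulrC.
rewrite (exchange_big_dep predT)//=; apply: eq_bigr => s _.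
rewrite mulr_suml -sumrMnl (big_ord_widen_cond a.+1 predT
  (fun i => ((u i * g ^+ (s - i)) *+ 'C(s, i) * x ^+ (a - s)) *+ 'C(a, s)))//.
apply: eq_big => [i|i _]; first by rewrite ltnS.
by rewrite /G mulrnAl -mulrnA mulnC.
Qed.

Lemma appell1Z a u k x : appell1 a (fun i => k * u i) x = k * appell1 a u x.
Proof.
by rewrite /appell1 mulr_sumr; apply: eq_bigr => i _; rewrite mulrnAr mulrA.
Qed.

Lemma appell1_sum (I : Type) (s : seq I) a (u : I -> nat -> F) x :
  appell1 a (fun i => \sum_(e <- s) u e i) x = \sum_(e <- s) appell1 a (u e) x.
Proof.
rewrite exchange_big/=; apply: eq_bigr => i _.
by rewrite mulr_suml -sumrMnl.
Qed.

Lemma appell1D a u v x :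
  appell1 a (fun i => u i + v i) x = appell1 a u x + appell1 a v x.
Proof.
by rewrite -big_split; apply: eq_bigr => i _; rewrite mulrDl mulrnDl.
Qed.

Lemma appell1_div a u x k : k != 0 ->
  appell1 a u (x / k) = k ^- a * appell1 a (fun i => k ^+ i * u i) x.
Proof.
move=> k0; rewrite /appell1 mulr_sumr; apply: eq_bigr => i _.
have le_ia : (i <= a)%N by rewrite -ltnS.
rewrite mulrnAr -[X in k ^- X](subnK le_ia) exprD expr_div_n.
by congr (_ *+ _); field; rewrite !expf_neq0.
Qed.

Lemma appell1_exchange a b h x y :
  appell1 a (fun i => appell1 b (h i) y) x =
  appell1 b (fun j => appell1 a (h^~ j) x) y.
Proof.
rewrite /appell1.
under eq_bigr do rewrite mulr_suml -sumrMnl.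
rewrite exchange_big/=; apply: eq_bigr => j _.
rewrite mulr_suml -sumrMnl; apply: eq_bigr => i _.
by rewrite !mulrnAl -!mulrnA [in RHS]mulnC mulrAC.
Qed.

Lemma appell1_delta a x : appell1 a (fun i => (i == a)%:R) x = 1.
Proof.
rewrite /appell1 big_ord_recr/= eqxx subnn mulr1 binn big1 ?add0r// => i _.
by rewrite ltn_eqF// mul0r mul0rn.
Qed.

Lemma appell1_delta0 a x : appell1 a (fun i => (i == 0%N)%:R) x = x ^+ a.
Proof.
rewrite /appell1 big_ord_recl/= subn0 mul1r bin0 mulr1n big1 ?addr0// => i _.
by rewrite mul0r mul0rn.
Qed.

Definition appell h a b x y := appell1 a (fun i => appell1 b (h i) y) x.

Lemma eq_appell h h' a b x y :
  (forall i j, (i <= a)%N -> (j <= b)%N -> h i j = h' i j) ->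
  appell h a b x y = appell h' a b x y.
Proof.
by move=> hh'; apply: eq_appell1 => i ia; apply: eq_appell1 => j; apply: hh'.
Qed.

Lemma appell_shift h a b x y g k :
  appell h a b (x + g) (y + k) =
  appell (fun s t => appell h s t g k) a b x y.
Proof.
rewrite /appell appell1_shift; apply: eq_appell1 => s _.
rewrite -(appell1_exchange s b (fun i t => appell1 t (h i) k)).
by apply: eq_appell1 => i _; rewrite appell1_shift.
Qed.

Lemma appell_sum (I : Type) (r : seq I) (h : I -> nat -> nat -> F) a b x y :
  appell (fun i j => \sum_(e <- r) h e i j) a b x y =
  \sum_(e <- r) appell (h e) a b x y.
Proof.
by rewrite -appell1_sum; apply: eq_appell1 => i _; rewrite appell1_sum.
Qed.

Lemma appellZ h k a b x y :
  appell (fun i j => k * h i j) a b x y = k * appell h a b x y.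
Proof. by rewrite -appell1Z; apply: eq_appell1 => i _; rewrite appell1Z. Qed.

Lemma appell_div h a b x y k l : k != 0 -> l != 0 ->
  appell h a b (x / k) (y / l) =
  k ^- a * l ^- b * appell (fun i j => k ^+ i * l ^+ j * h i j) a b x y.
Proof.
move=> k0 l0; rewrite /appell appell1_div// -mulrA; congr (_ * _).
rewrite -[RHS]appell1Z; apply: eq_appell1 => i _.
rewrite appell1_div// mulrCA; congr (_ * _).
by rewrite -[LHS]appell1Z; apply: eq_appell1 => j _; rewrite mulrA.
Qed.

(** Isolating the coefficient of top index lets a recursion on h be solved for
    [h a b]. *)
Lemma appell_top h a b x y :
  appell h a b x y = h a b + appell
    (fun i j => if (i == a) && (j == b) then 0 else h i j) a b x y.
Proof.
set h' := fun i j => _.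
have -> : h a b =
    appell (fun i j => h a b * ((i == a)%:R * (j == b)%:R)) a b x y.
  rewrite appellZ /appell -[LHS]mulr1; congr (_ * _).
  rewrite -[LHS](appell1_delta a x); apply: eq_appell1 => i _.
  by rewrite appell1Z appell1_delta mulr1.
rewrite /appell -appell1D; apply: eq_appell1 => i _.
rewrite -appell1D; apply: eq_appell1 => j _.
rewrite /h'; case: (eqVneq i a) => [->|_]; last by rewrite mul0r mulr0 add0r.
by case: (eqVneq j b) => [->|_] /=; rewrite ?mulr1 ?mulr0 ?addr0 ?add0r.
Qed.

(** Averages of Appell polynomials depend on the nodes only through their
    moments of order at most a + b; this is how moment identities are
    transferred to Appell polynomials. *)
Lemma appell_moments (I : Type) (r : seq I) (w x y : I -> F) h a b :
  \sum_(e <- r) w e * appell h a b (x e) (y e) =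
  appell (fun i j => h i j *
    \sum_(e <- r) w e * (x e ^+ (a - i) * y e ^+ (b - j))) a b 1 1.
Proof.
under eq_bigr do rewrite -appellZ.
rewrite /appell /appell1.
under eq_bigr do under eq_bigr do (rewrite mulr_suml -sumrMnl).
rewrite exchange_big/=; apply: eq_bigr => i _.
rewrite exchange_big/= mulr_suml -sumrMnl; apply: eq_bigr => j _.
rewrite !expr1n !mulr1 mulr_sumr -!sumrMnl; apply: eq_bigr => e _.
rewrite !mulrnAl -!mulrnA; congr (_ *+ _).
by ring.
Qed.

(** If H and W are the exponential generating functions of h and of the moments
    of the weights, the equation reads H(k s, l t) W(s, t) = H(s, t) up to
    order N.  Comparing coefficients gives [(1 - k^a l^b) h a b] in terms of the
    entries of smaller index, and [k^a l^b = 1] happens only at a = b = 0; hence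
    the recursion on a + b. *)
Lemma appell_fixpoint (I : Type) (r : seq I) (w x y : I -> F) k l N :
  \sum_(e <- r) w e = 1 -> 1 < k -> 1 < l ->
  exists h, h 0%N 0%N = 1 /\ forall a b, (a + b <= N)%N ->
    \sum_(e <- r) w e *
      appell (fun i j => k ^+ i * l ^+ j * h i j) a b (x e) (y e) = h a b.
Proof.
move=> w1 k1 l1; elim: N => [|N [h [h0 IH]]].
  exists (fun _ _ => 1); split=> // a b.
  rewrite leqn0 addn_eq0 => /andP[/eqP-> /eqP->].
  rewrite -[RHS]w1; apply: eq_bigr => e _.
  by rewrite /appell /appell1 !big_ord1 !expr0 !bin0 !mulr1n !mulr1.
pose S h a b := \sum_(e <- r) w e * appell (fun i j =>
  if (i == a) && (j == b) then 0 else k ^+ i * l ^+ j * h i j) a b (x e) (y e).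
pose h' a b := if (a + b <= N)%N then h a b
  else S h a b / (1 - k ^+ a * l ^+ b).
exists h'; split=> [|a b ab]; first by rewrite /h' addn0 leq0n.
have hh' i j : (i + j <= N)%N -> h' i j = h i j by rewrite /h' => ->.
have [abN|abN] := leqP (a + b) N.
  rewrite hh'// -[RHS]IH//; apply: eq_bigr => e _; congr (_ * _).
  by apply: eq_appell => i j ia jb; rewrite hh'//; lia.
have Sh : S h' a b = S h a b.
  apply: eq_bigr => e _; congr (_ * _); apply: eq_appell => i j ia jb.
  by case: ifPn => // ij; rewrite hh'//; lia.
under eq_bigr do rewrite appell_top mulrDr.
rewrite big_split/= -mulr_suml w1 mul1r -/(S h' a b) Sh.
have nz : 1 - k ^+ a * l ^+ b != 0.
  rewrite subr_eq0 eq_sym gt_eqF//.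
  have ka : 1 <= k ^+ a by rewrite exprn_ege1// ltW.
  have lb : 1 <= l ^+ b by rewrite exprn_ege1// ltW.
  have [a0|a0] := posnP a.
    by rewrite a0 expr0 mul1r exprn_egt1// -lt0n; lia.
  have ka' : 1 < k ^+ a by rewrite exprn_egt1// -lt0n.
  by rewrite (lt_le_trans ka')// ler_peMr// (le_trans _ ka).
by rewrite /h' leqNgt abN/=; field.
Qed.

End Appell.

(** * The subdivision operator on sequences *)

Section Subdivision.
Variables (R : realType) (p : int * int -> R) (s : seq (int * int)).
Hypotheses (s_uniq : uniq s) (p_supp : forall a, a \notin s -> p a = 0).

(** For a in the coset of alpha, this is the b with alpha = M b + a, that is,
    the coarse point through which the mask entry at a contributes at alpha. *)
Definition parent (alpha a : int * int) : int * int :=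
  (((alpha.1 - a.1) %/ 2)%Z, ((alpha.2 - a.2) %/ 3)%Z).

Lemma parentK alpha a :
  coset_member alpha a -> dilate (parent alpha a) = alpha - a.
Proof.
case/andP=> d2 d3; rewrite /dilate /parent/= mulrC divzK//.
by rewrite mulrC divzK.
Qed.

Lemma dilate_inj : injective dilate.
Proof. by case=> a b [c d] [] H1 H2; congr (_, _); lia. Qed.

Lemma coset_member_dilate (alpha beta : int * int) :
  coset_member alpha (alpha - dilate beta).
Proof.
by rewrite /coset_member /dilate /= !subKr !dvdz_mulr.
Qed.

(** Summing over the support of the mask instead of over the coarse lattice
    turns [subdivision] into a finite sum whatever the sequence [c] is. *)
Lemma subdivisionE c alpha : subdivision p c alpha =
  \sum_(a <- s | coset_member alpha a) p a * c (parent alpha a).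
Proof.
pose r := [seq parent alpha a | a <- s & coset_member alpha a].
rewrite /subdivision (@fsum_seq _ _ r).
- rewrite big_map big_filter; apply: eq_bigr => a ma.
  by rewrite parentK// subKr.
- rewrite map_inj_in_uniq ?filter_uniq// => a b.
  rewrite !mem_filter => /andP[ma _] /andP[mb _] /(congr1 dilate).
  by rewrite !parentK// => /addrI/oppr_inj.
- move=> b nb; rewrite p_supp ?mul0r//; apply: contra nb => sb.
  have mb := coset_member_dilate alpha b.
  apply/mapP; exists (alpha - dilate b); first by rewrite mem_filter mb.
  by apply: dilate_inj; rewrite parentK// subKr.
Qed.

Lemma subdivision_shifts (B : seq (int * int)) (q : int * int -> R)
    (u : int * int -> R) (m : int * int -> int * int) alpha :
  subdivision p (fun b => \sum_(e <- B) q e * u (b - m e)) alpha =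
  \sum_(e <- B) q e * subdivision p u (alpha - dilate (m e)).
Proof.
rewrite subdivisionE; under eq_bigr do rewrite mulr_sumr.
rewrite exchange_big/=; apply: eq_bigr => e _.
rewrite subdivisionE mulr_sumr.
have cE a : coset_member (alpha - dilate (m e)) a = coset_member alpha a.
  by rewrite /coset_member /dilate/=; lia.
apply: eq_big => [a|a]; first by rewrite cE.
move=> ma; rewrite mulrCA; congr (_ * (_ * u _)).
apply: dilate_inj; rewrite parentK ?cE//.
have -> : dilate (parent alpha a - m e) =
    dilate (parent alpha a) - dilate (m e).
  by rewrite /dilate/= !mulrBr.
by rewrite parentK// addrAC.
Qed.

(** The operator is linear and turns translation by e into translation by
    M e. *)
Lemma iter_subdivision_shifts (B : seq (int * int)) (q : int * int -> R)
    (u : int * int -> R) k alpha :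
  iter k (subdivision p) (fun b => \sum_(e <- B) q e * u (b - e)) alpha =
  \sum_(e <- B) q e * iter k (subdivision p) u (alpha - iter k dilate e).
Proof.
elim: k alpha => [//|k IH] alpha.
rewrite iterS (funext IH).
exact: (subdivision_shifts B q (iter k (subdivision p) u) (iter k dilate)).
Qed.

Lemma iter_dilate k (b : int * int) :
  iter k dilate b = (2 ^+ k * b.1, 3 ^+ k * b.2).
Proof.
by elim: k => [|k IH]; rewrite ?expr0 ?mul1r -?surjective_pairing// iterS IH
  /dilate/= !exprS !mulrA.
Qed.

Variable K : int.
Hypothesis K_ge0 : 0 <= K.
Hypothesis s_box : forall a, a \in s -> `|a.1| <= K /\ `|a.2| <= K.

(** One step only looks at coarse points b with |alpha - M b| <= K, and these
    errors add up to a geometric series. *)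
Lemma iter_subdivision_local k (c c' : int * int -> R) alpha :
  (forall b, `|alpha.1 - (iter k dilate b).1| <= K * 2 ^+ k ->
     `|alpha.2 - (iter k dilate b).2| <= K * 3 ^+ k -> c b = c' b) ->
  iter k (subdivision p) c alpha = iter k (subdivision p) c' alpha.
Proof.
move=> H.
(* The sharper radius K (2^k - 1) is what the induction reproduces:
   2 K (2^k - 1) + K = K (2^(k+1) - 1), and the factor 3 is only better. *)
have {H} : forall b, `|alpha.1 - (iter k dilate b).1| <= K * 2 ^+ k - K ->
   `|alpha.2 - (iter k dilate b).2| <= K * 3 ^+ k - K -> c b = c' b.
  by move=> b H1 H2; apply: H; [move: H1|move: H2]; lia.
elim: k alpha => [|k IH] alpha H.
  by apply: H; rewrite /= subrr normr0 expr0 mulr1 subrr.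
rewrite !iterS !subdivisionE big_seq_cond [RHS]big_seq_cond.
apply: eq_bigr => a /andP[sa ma].
congr (_ * _); apply: IH => b; rewrite !iter_dilate => H1 H2.
have [a1 a2] := s_box sa; have [e1 e2] : dilate (parent alpha a) = alpha - a.
  exact: parentK.
apply: H; rewrite iter_dilate/= !exprS.
  move: H1 e1 a1; rewrite /=; set t := 2 ^+ k; set x := (_ %/ _)%Z.
  rewrite -[2 * t * _]mulrA; set y := t * _; rewrite mulrCA; lia.
move: H2 e2 a2; rewrite /=; set t := 3 ^+ k; set x := (_ %/ _)%Z.
rewrite -[3 * t * _]mulrA; set y := t * _; rewrite mulrCA; lia.
Qed.

End Subdivision.

(** * Limits along the refined grids *)

Section Limits.
Variable R : realType.
Local Open Scope classical_set_scope.

Lemma cvg_lsum (I : Type) (r : seq I) (f : I -> nat -> R) (l : I -> R) :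
  (forall i, f i k @[k --> \oo] --> l i) ->
  \sum_(i <- r) f i k @[k --> \oo] --> \sum_(i <- r) l i.
Proof. by move=> H; apply: cvg_big => //; exact: add_continuous. Qed.

Lemma cvg_appell1 a (u : nat -> nat -> R) (x : nat -> R) v y :
  (forall i, u k i @[k --> \oo] --> v i) -> x k @[k --> \oo] --> y ->
  appell1 a (u k) (x k) @[k --> \oo] --> appell1 a v y.
Proof.
move=> uv xy; apply: cvg_lsum => i; apply: cvgMn; apply: cvgM; first exact: uv.
exact: (cvg_comp _ _ xy (@exprn_continuous R (a - i) y)).
Qed.

Lemma cvg_floor_scaled (d : R) x : 1 < d ->
  (Num.floor (d ^+ k * x))%:~R / d ^+ k @[k --> \oo] --> x.
Proof.
move=> d1; have d0 k : 0 < d ^+ k by rewrite exprn_gt0// (lt_trans _ d1).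
have lim : x - (d^-1) ^+ k @[k --> \oo] --> x.
  rewrite -[X in _ --> X]subr0; apply: cvgB; first exact: cvg_cst.
  apply: cvg_expr; rewrite ger0_norm ?invr_ge0 ?(le_trans _ (ltW d1))//.
  by rewrite invf_lt1// (lt_trans _ d1).
apply: (squeeze_cvgr _ lim (cvg_cst x)); apply: nearW => k.
have /andP[f1 f2] := floor_itv (d ^+ k * x).
rewrite ler_pdivrMr// [x * _]mulrC f1 andbT ler_pdivlMr// mulrBl exprVn.
by rewrite mulVf ?gt_eqF// [x * _]mulrC lerBlDr ltW// -intrD1.
Qed.

(** Uniform convergence on the grids, combined with continuity of the limit
    function, allows the grid point to move with k. *)
Lemma limit_function_cvg p c (F : R * R -> R) (alpha : nat -> int * int) x :
  is_limit_function p c F ->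
  (alpha k).1%:~R / 2 ^+ k @[k --> \oo] --> x.1 ->
  (alpha k).2%:~R / 3 ^+ k @[k --> \oo] --> x.2 ->
  iter k (subdivision p) c (alpha k) @[k --> \oo] --> F x.
Proof.
move=> [Fu Fsup] lim1 lim2.
have FG : F (grid_point R k (alpha k)) @[k --> \oo] --> F x.
  apply/cvg_ballP => e e0.
  have [d d0 Fd] := (unif_continuousP F).1 Fu e e0.
  have /cvg_ballP/(_ d d0) b1 := lim1; have /cvg_ballP/(_ d d0) b2 := lim2.
  by near=> k; apply: (Fd (x, grid_point R k (alpha k))); split; near: k.
have D0 : `|F (grid_point R k (alpha k)) - iter k (subdivision p) c (alpha k)|
    @[k --> \oo] --> (0 : R).
  suff /fine_cvg : `|F (grid_point R k (alpha k))
      - iter k (subdivision p) c (alpha k)|%:E @[k --> \oo] --> 0%:E by [].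
  apply: (squeeze_cvge _ (cvg_cst 0%:E) Fsup); apply: nearW => k.
  by rewrite lee_fin normr_ge0 ereal_sup_ubound//; exists (alpha k).
have /cvgB/(_ (norm_cvg0 D0)) := FG.
by rewrite subr0; apply: cvg_trans; apply: near_eq_cvg; apply: nearW => k /=;
  rewrite subKr.
Unshelve. all: by end_near. Qed.

End Limits.

(** * Boxes of lattice points and polynomial eigensequences *)

Definition zbox (L : nat) : seq (int * int) :=
  let zs := [seq k%:Z - L%:Z | k <- iota 0 (2 * L).+1] in
  [seq (x, y) | x <- zs, y <- zs].

Lemma zbox_uniq L : uniq (zbox L).
Proof.
have zs_uniq : uniq [seq k%:Z - L%:Z | k <- iota 0 (2 * L).+1].
  by rewrite map_inj_uniq ?iota_uniq// => i j; lia.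
by apply: allpairs_uniq => // -[a b] [c d] _ _ [-> ->].
Qed.

Lemma mem_zbox L (a : int * int) :
  `|a.1| <= L%:Z -> `|a.2| <= L%:Z -> a \in zbox L.
Proof.
case: a => x y /= xL yL; apply/allpairsP; exists (x, y); split=> //.
  by apply/mapP; exists `|(x + L%:Z)%R|%N; rewrite ?mem_iota/=; lia.
by apply/mapP; exists `|(y + L%:Z)%R|%N; rewrite ?mem_iota/=; lia.
Qed.

Section Generation.
Variables (R : realType) (n l : nat) (c : nat -> nat -> R) (p : int * int -> R).
Hypothesis l_lt_n : (l < n)%N.
Hypothesis symB11 : symBnl n l c 1 1 = 6.
Hypothesis mask_p : is_mask p (symBnl n l c).
Variable s : seq (int * int).
Hypotheses (s_uniq : uniq s) (p_supp : forall a, a \notin s -> p a = 0).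

(** Sum rules let the sum over the coset of alpha be replaced by 1/6 of the sum
    over the whole mask, after which the shift and dilation rules for Appell
    polynomials reduce the eigenvalue equation to [appell_fixpoint], applied to
    the weights p / 6, of total mass 1, at the nodes -e. *)
Lemma eigensequences : exists h : nat -> nat -> R, h 0%N 0%N = 1 /\
  forall a b, (a + b < 2 * n)%N ->
  subdivision p (fun e => appell h a b e.1%:~R e.2%:~R) =
  (fun e => 2 ^- a * 3 ^- b * appell h a b e.1%:~R e.2%:~R).
Proof.
have w1 : \sum_(e <- s) 6^-1 * p e = 1.
  by rewrite -mulr_sumr (mask_sum mask_p s_uniq p_supp symB11) mulVf.
have [h [h0 hE]] := appell_fixpoint (fun e : int * int => - e.1%:~R)
  (fun e : int * int => - e.2%:~R) (2 * n).-1 w1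
  (ltr1n R 2 : 1 < 2) (ltr1n R 3 : 1 < 3).
exists h; split=> // a b ab; apply/funext => alpha.
rewrite (subdivisionE s_uniq p_supp).
pose h' i j := 2 ^+ i * 3 ^+ j * h i j.
transitivity (\sum_(e <- s | coset_member alpha e) 2 ^- a * 3 ^- b *
    (p e * appell h' a b (alpha.1%:~R - e.1%:~R) (alpha.2%:~R - e.2%:~R))).
  apply: eq_bigr => e ce; rewrite mulrCA -appell_div ?pnatr_eq0//.
  have [e1 e2] := parentK ce.
  congr (_ * appell _ _ _ _ _).
    have := congr1 (fun z : int => z%:~R : R) e1; rewrite /= intrM intrB => <-.
    by rewrite [X in _ = X / _]mulrC mulfK ?intr_eq0.
  have := congr1 (fun z : int => z%:~R : R) e2; rewrite /= intrM intrB => <-.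
  by rewrite [X in _ = X / _]mulrC mulfK ?intr_eq0.
rewrite -mulr_sumr; congr (_ * _).
under eq_bigr do rewrite appell_shift -appellZ.
rewrite -big_filter -appell_sum; apply: eq_appell => i j ia jb.
rewrite -[RHS]hE; last by lia.
rewrite !appell_moments; apply: eq_appell => i' j' ii jj; congr (_ * _).
have sgn (e : int * int) u v : (- e.1%:~R) ^+ u * (- e.2%:~R) ^+ v =
    (-1) ^+ (u + v) * (e.1%:~R ^+ u * e.2%:~R ^+ v) :> R.
  by rewrite (exprNn _ u) (exprNn _ v) exprD mulrACA.
have d2n : (i - i' + (j - j') < 2 * n)%N by lia.
rewrite big_filter.
under eq_bigr do rewrite sgn mulrCA.
under [RHS]eq_bigr do rewrite sgn mulrCA -mulrA.
rewrite -!mulr_sumr; congr (_ * _).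
by rewrite (coset_moments l_lt_n mask_p s_uniq p_supp alpha d2n).
Qed.

End Generation.

(** * Reproduction of monomials by the shifts of the basic limit function *)

Section Shifts.
Variables (R : realType) (p : int * int -> R) (s : seq (int * int)).
Hypotheses (s_uniq : uniq s) (p_supp : forall a, a \notin s -> p a = 0).
Local Open Scope classical_set_scope.

Lemma iter_subdivision_eigen (q : int * int -> R) r k :
  subdivision p q = (fun e => r * q e) ->
  iter k (subdivision p) q = (fun e => r ^+ k * q e).
Proof.
move=> Sq; elim: k => [|k IH].
  by apply/funext => e; rewrite expr0 mul1r.
rewrite iterS IH; apply/funext => e.
rewrite (subdivisionE s_uniq p_supp).
under eq_bigr do rewrite mulrCA.
by rewrite -mulr_sumr -(subdivisionE s_uniq p_supp) Sq exprSr mulrA.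
Qed.

Variable K : nat.
Hypothesis s_box : forall a, a \in s -> `|a.1| <= K%:Z /\ `|a.2| <= K%:Z.

(** M^-k [base_point x k] tends to x. *)
Definition base_point (x : R * R) k : int * int :=
  (Num.floor (2 ^+ k * x.1), Num.floor (3 ^+ k * x.2)).

(** Only the shifts by b in the box of this radius matter at x, at every
    refinement level k at once: |M^k b - base_point x k| <= K M^k forces
    |b| <= K + 1 + |x|. *)
Definition radius (x : R * R) : nat :=
  (K + 1 + Num.bound `|x.1| + Num.bound `|x.2|)%N.

Lemma near_floor_bounded (d : nat) (x : R) k (b : int) (L : nat) : (0 < d)%N ->
  (K + 1 + Num.bound `|x| <= L)%N ->
  `|Num.floor (d%:R ^+ k * x) - d%:Z ^+ k * b| <= K%:Z * d%:Z ^+ k ->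
  `|b| <= L%:Z.
Proof.
move=> d0 KL close; rewrite -(ler_int R).
have dk : 1 <= d%:R ^+ k :> R by rewrite exprn_ege1// ler1n.
have dk0 : 0 < d%:R ^+ k :> R by rewrite (lt_le_trans _ dk).
have {close} : `|(Num.floor (d%:R ^+ k * x))%:~R - d%:R ^+ k * b%:~R|
    <= K%:R * d%:R ^+ k :> R.
  move: close; rewrite -(ler_int R) intr_norm intrB !intrM.
  by rewrite !rmorphXn/=.
have /andP[f1 f2] := floor_itv (d%:R ^+ k * x).
rewrite intrD in f2.
have xb := archi_boundP (normr_ge0 x).
have LR : K%:R + 1 + (Num.bound `|x|)%:R <= L%:R :> R.
  by move: KL; rewrite -(ler_nat R) !natrD.
set D := d%:R ^+ k in dk dk0 f1 f2 *; set f := (Num.floor _)%:~R in f1 f2 *.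
rewrite ler_norml => /andP[h1 h2]; rewrite intr_norm.
rewrite -(ler_pM2l dk0) -[D in D * `|_|]gtr0_norm// -normrM ler_norml.
have [x1 x2] : - `|x| <= x /\ x <= `|x|.
  by split; [rewrite lerNl -normrN ler_norm | exact: ler_norm].
have y : `|x| <= L%:R - K%:R - 1 by lra.
have y1 : D * x <= D * (L%:R - K%:R - 1) by rewrite ler_pM2l//; lra.
have y2 : D * - (L%:R - K%:R - 1) <= D * x by rewrite ler_pM2l//; lra.
by apply/andP; split; lra.
Qed.

Lemma zbox_radius x k b :
  `|(base_point x k).1 - (iter k dilate b).1| <= K%:Z * 2 ^+ k ->
  `|(base_point x k).2 - (iter k dilate b).2| <= K%:Z * 3 ^+ k ->
  b \in zbox (radius x).
Proof.
rewrite iter_dilate /= => H1 H2; apply: mem_zbox.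
  by apply: near_floor_bounded H1; rewrite // /radius; lia.
by apply: near_floor_bounded H2; rewrite // /radius; lia.
Qed.

Variables (phi : R * R -> R).
Hypothesis phi_lim : is_limit_function p (@delta_seq R) phi.

Lemma shift_cvg x (b : int * int) :
  iter k (subdivision p) (@delta_seq R) (base_point x k - iter k dilate b)
    @[k --> \oo] --> phi (x - (b.1%:~R, b.2%:~R)).
Proof.
have key (d : nat) (y : R) (j : int) : (1 < d)%N ->
    (Num.floor (d%:R ^+ k * y) - d%:Z ^+ k * j)%:~R / d%:R ^+ k
      @[k --> \oo] --> y - j%:~R.
  move=> d1; have dR : 1 < d%:R :> R by rewrite ltr1n.
  have lim : (Num.floor (d%:R ^+ k * y))%:~R / d%:R ^+ k - j%:~R
      @[k --> \oo] --> y - j%:~R.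
    by apply: cvgB; [exact: cvg_floor_scaled | exact: cvg_cst].
  apply: cvg_trans lim; apply: near_eq_cvg.
  apply: nearW => k /=; rewrite intrB intrM mulrBl.
  rewrite (_ : (d%:Z ^+ k)%:~R = d%:R ^+ k) ?rmorphXn//=.
  by rewrite mulrAC divff ?mul1r// expf_neq0// pnatr_eq0 -lt0n ltnW.
apply: limit_function_cvg phi_lim _ _ => /=.
  under eq_cvg do rewrite iter_dilate.
  exact: (key 2%N).
under eq_cvg do rewrite iter_dilate.
exact: (key 3%N).
Qed.

Lemma iter_subdivision0 k alpha : iter k (subdivision p) (fun=> 0) alpha = 0.
Proof.
have := iter_subdivision_shifts s_uniq p_supp [::] (@delta_seq R)
  (@delta_seq R) k alpha.
by under eq_fun do rewrite big_nil; rewrite big_nil.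
Qed.

(** For these b the values whose limit is phi(x - b) all vanish, by locality:
    [delta_seq] agrees with 0 on the part of Z^2 that is seen. *)
Lemma shift_support x b : b \notin zbox (radius x) ->
  phi (x - (b.1%:~R, b.2%:~R)) = 0.
Proof.
move=> nb; have lim := @shift_cvg x b.
apply: (cvg_unique _ lim) => //.
have zero : (fun=> 0 : R) @ \oo --> (0 : R) by exact: cvg_cst.
apply: cvg_trans zero; apply: near_eq_cvg; apply: nearW => k /=.
rewrite -(iter_subdivision0 k (base_point x k - iter k dilate b)).
apply: (iter_subdivision_local s_uniq p_supp _ s_box) => // e H1 H2.
rewrite /delta_seq; case: eqP => // e0; case/negP: nb.
move: H1 H2; rewrite {}e0 !iter_dilate/= !mulr0 !subr0 => H1 H2.
by apply: (@zbox_radius x k); rewrite iter_dilate.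
Qed.

Lemma shift_sum (q : int * int -> R) x :
  \sum_(b \in [set: int * int]) q b * phi (x - (b.1%:~R, b.2%:~R)) =
  \sum_(b <- zbox (radius x)) q b * phi (x - (b.1%:~R, b.2%:~R)).
Proof.
apply: fsum_seq; first exact: zbox_uniq.
by move=> b /shift_support ->; rewrite mulr0.
Qed.

(** By locality q may be replaced by its truncation to the box, a finite
    combination of translates of [delta_seq]. *)
Lemma iter_subdivision_cvg (q : int * int -> R) x :
  iter k (subdivision p) q (base_point x k) @[k --> \oo] -->
  \sum_(b <- zbox (radius x)) q b * phi (x - (b.1%:~R, b.2%:~R)).
Proof.
have qdelta b : b \in zbox (radius x) ->
    \sum_(e <- zbox (radius x)) q e * @delta_seq R (b - e) = q b.
  move=> bB; rewrite (bigD1_seq b) ?zbox_uniq//= big1 => [|e eb].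
    by rewrite /delta_seq subrr eqxx mulr1 addr0.
  by rewrite /delta_seq subr_eq0 eq_sym (negPf eb) mulr0.
have : \sum_(e <- zbox (radius x)) q e *
      iter k (subdivision p) (@delta_seq R) (base_point x k - iter k dilate e)
    @[k --> \oo] -->
    \sum_(b <- zbox (radius x)) q b * phi (x - (b.1%:~R, b.2%:~R)).
  by apply: cvg_lsum => e; apply: cvgM; [exact: cvg_cst | exact: shift_cvg].
apply: cvg_trans; apply: near_eq_cvg; apply: nearW => k /=.
rewrite -(iter_subdivision_shifts s_uniq p_supp).
apply: (iter_subdivision_local s_uniq p_supp _ s_box) => // e H1 H2.
by rewrite qdelta//; apply: zbox_radius H1 H2.
Qed.

(** S^k q at alpha_k = [base_point x k] is 2^-ka 3^-kb q(alpha_k).  By the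
    dilation rule this is the Appell polynomial at M^-k alpha_k of the array
    2^-ki 3^-kj h i j, of which only the entry h 0 0 = 1 survives in the
    limit. *)
Lemma appell_reproduction (h : nat -> nat -> R) a b x : h 0%N 0%N = 1 ->
  subdivision p (fun e => appell h a b e.1%:~R e.2%:~R) =
    (fun e => 2 ^- a * 3 ^- b * appell h a b e.1%:~R e.2%:~R) ->
  \sum_(e <- zbox (radius x)) appell h a b e.1%:~R e.2%:~R *
    phi (x - (e.1%:~R, e.2%:~R)) = x.1 ^+ a * x.2 ^+ b.
Proof.
move=> h0 /iter_subdivision_eigen Sh.
have lim := @iter_subdivision_cvg (fun e => appell h a b e.1%:~R e.2%:~R) x.
apply: (cvg_unique _ lim) => //=.
have geo (d : R) i : 1 < d ->
    (d ^+ k) ^- i @[k --> \oo] --> ((i == 0%N)%:R : R).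
  move=> d1; case: i => [|i].
    by under eq_cvg do rewrite expr0 invr1; exact: cvg_cst.
  under eq_cvg do rewrite -exprM mulnC exprM -exprVn.
  apply: cvg_expr; have d0 := lt_trans ltr01 d1.
  rewrite ger0_norm ?invr_ge0 ?exprn_ge0 ?ltW//.
  by rewrite invf_lt1 ?exprn_gt0// exprn_egt1.
have -> : x.1 ^+ a * x.2 ^+ b =
    appell (fun i j => (i == 0%N)%:R * ((j == 0%N)%:R * h i j)) a b x.1 x.2.
  transitivity (appell1 a (fun i => x.2 ^+ b * (i == 0%N)%:R) x.1).
    by rewrite appell1Z appell1_delta0 mulrC.
  apply: eq_appell1 => i _; rewrite appell1Z mulrC.
  case: i => [|i]; last by rewrite !mul0r.
  congr (_ * _); rewrite -(appell1_delta0 b x.2); apply: eq_appell1 => j _.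
  by case: j => [|j]; rewrite ?h0 ?mulr1 ?mul0r.
have : appell (fun i j => (2 ^+ k) ^- i * ((3 ^+ k) ^- j * h i j)) a b
      ((base_point x k).1%:~R / 2 ^+ k) ((base_point x k).2%:~R / 3 ^+ k)
    @[k --> \oo] -->
    appell (fun i j => (i == 0%N)%:R * ((j == 0%N)%:R * h i j)) a b x.1 x.2.
  apply: cvg_appell1 => [i|]; last by apply: cvg_floor_scaled; rewrite ltr1n.
  apply: cvg_appell1 => [j|]; last by apply: cvg_floor_scaled; rewrite ltr1n.
  apply: cvgM; first by apply: geo; rewrite ltr1n.
  by apply: cvgM; [apply: geo; rewrite ltr1n | exact: cvg_cst].
apply: cvg_trans; apply: near_eq_cvg; apply: nearW => k /=.
rewrite Sh appell_div ?expf_neq0 ?pnatr_eq0//.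
congr (_ * _).
  by rewrite exprMn !exprVn -!exprM ![(k * _)%N]mulnC.
apply: eq_appell => i j _ _.
have t0 : (2 ^+ k) ^+ i != 0 :> R by rewrite !expf_neq0// pnatr_eq0.
have u0 : (3 ^+ k) ^+ j != 0 :> R by rewrite !expf_neq0// pnatr_eq0.
by rewrite -[LHS]mulrA [X in _ * X = _]mulrCA mulVKf ?mulVKf.
Qed.

End Shifts.

Theorem proposition4p7 (R : realType) (n l : nat)
    (c : nat -> nat -> R) (p : int * int -> R)
    (n_ge1 : (1 <= n)%N) (l_lt_n : (l < n)%N)
    (coef_c : scheme_coefficients n l c)
    (mask_p : is_mask p (symBnl n l c))
    (conv_p : convergent p) :
  generates_polynomials p (2 * n - 1)%N.
Proof.
have /finite_seqP[s0 s0E] := mask_p.1; pose s := undup s0.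
have s_uniq : uniq s := undup_uniq s0.
have p_supp a : a \notin s -> p a = 0.
  rewrite mem_undup => as0; apply/eqP; apply: contraNT as0 => pa.
  by have : [set` s0]%classic a by rewrite -s0E.
pose K := (\sum_(a <- s) (`|a.1| + `|a.2|))%N.
have s_box a : a \in s -> `|a.1| <= K%:Z /\ `|a.2| <= K%:Z.
  move=> sa; have : (`|a.1| + `|a.2| <= K)%N.
    by rewrite /K (big_rem a)//= leq_addr.
  by split; lia.
have [phi phi_lim] : exists phi, is_limit_function p (@delta_seq R) phi.
  by apply: conv_p; exists 1 => a; rewrite /delta_seq; case: eqP;
    rewrite ?normr1 ?normr0 ?ler01.
exists phi; split=> // q [C qE].
have [h [h0 hE]] := eigensequences l_lt_n coef_c.1 mask_p s_uniq p_supp.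
exists (fun e => \sum_(i < (2 * n - 1).+1)
  \sum_(j < (2 * n - 1).+1 | (i + j <= 2 * n - 1)%N)
    C i j * appell h i j e.1%:~R e.2%:~R) => x.
rewrite (shift_sum s_uniq p_supp s_box phi_lim) qE.
under eq_bigr do rewrite mulr_suml.
rewrite exchange_big/=; apply: eq_bigr => i _.
under eq_bigr do rewrite mulr_suml.
rewrite exchange_big/=; apply: eq_bigr => j ij.
under eq_bigr do rewrite -mulrA.
rewrite -mulr_sumr -mulrA; congr (_ * _).
by apply: (appell_reproduction s_uniq p_supp s_box phi_lim _ h0);
  rewrite hE//; lia.
Qed.
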